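(* Let $1<Q<+\infty$. Suppose that $(X,d,\mu)$ is an unbounded metric measure space with metric $d$ and Ahlfors $Q$-regular measure $\mu$, supporting a $p$-Poincaré inequality for some $1\le p<+\infty$. Let $E\subset X$ be a thin set. Then $F:=X\setminus E$ is a thick set.
   Context: A metric measure space $(X,d,\mu)$ is a separable metric space $(X,d)$ with a nontrivial locally finite Borel-regular measure $\mu$. $B(x,r)$ is the ball of center $x$ and radius $r$, and $O\in X$ is a fixed base point. $\mu$ is Ahlfors $Q$-regular if there is a constant $C_Q\ge1$ with $r^Q/C_Q\le\mu(B(x,r))\le C_Qr^Q$ for all $x\in X$, $r>0$. Upper gradient: a Borel function $\rho:X\to[0,+\infty]$ is an upper gradient of a locally integrable function $u$ if $|u(x)-u(y)|\le\int_\gamma\rho\,ds$ for every rectifiable curve $\gamma$ connecting $x$ and $y$ (for all $x,y\in X$). $p$-Poincaré inequality: every ball has finite positive measure and there are finite constants $C>0$, $\lambda\ge1$ such that $\frac1{\mu(B(x,r))}\int_{B(x,r)}|u-u_{B(x,r)}|\,d\mu\le Cr\left(\frac1{\mu(B(x,\lambda r))}\int_{B(x,\lambda r)}\rho^p\,d\mu\right)^{1/p}$ for all balls $B(x,r)$ and all pairs $(u,\rho)$ with $u$ integrable on balls and $\rho$ an upper gradient of $u$, where $u_A=\frac1{\mu(A)}\int_Au\,d\mu$. Hausdorff content: for $\beta\ge0$, $\mathcal H^\beta_{+\infty}(E)=\inf\{\sum_kr_k^\beta: E\subset\bigcup_kB_k,\ B_k \text{ a ball of radius } r_k\in(0,+\infty)\}$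 (countable covers). For $C\ge1$, $A_{C2^{j+1}}:=B(O,C2^{j+2})\setminus B(O,C2^{j+1})$. Thin set (i.e. $Q$-thin): $E\subset X$ such that there is a finite constant $C\ge1$ with $\lim_{k\to+\infty}\sum_{j=k}^{+\infty}\frac{\mathcal H^{\alpha}_{+\infty}(E\cap A_{C2^{j+1}})}{(C2^{j+1})^\alpha}=0$ for all $0<\alpha<Q$. Thick set: an unbounded set $F\subset X$ such that for every $0<\alpha<Q$ there are finite constants $\delta>0$, $k\in\mathbb N$ and $C\ge1$ with $\mathcal H^\alpha_{+\infty}(F\cap A_{C2^{j+1}})\ge\delta(2^{j+1})^\alpha$ for all $j\ge k$. *)

(* Defs.v *)
From HB Require Import structures.
From mathcomp Require Import all_boot all_order all_algebra.
From mathcomp Require Import all_classical all_reals all_analysis measurable_realfun.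

Set Implicit Arguments.
Unset Strict Implicit.
Unset Printing Implicit Defensive.

Import Order.TTheory GRing.Theory Num.Theory.
Import numFieldNormedType.Exports.

Local Open Scope classical_set_scope.
Local Open Scope ring_scope.

(* Measurable types are pointed in MathComp-Analysis. The point only witnesses
   that the space is nonempty; base points are explicit arguments below. *)
#[short(type="pmetricType")]
HB.structure Definition PointedMetric (K : numDomainType) :=
  {M of Pointed M & Metric K M}.

Section MetricSpace.
Context {R : realType} {X : pmetricType R}.
Implicit Types (A E F : set X) (O x : X) (g : R -> X).

Definition separable_space := exists D : set X, countable D /\ dense D.

Definition metric_bounded A :=
  exists M : R, forall x y, A x -> A y -> mdist x y <= M.

Definition borel : set (set X) := <<s @open X >>.

Definition curve_length (a b : R) g : \bar R :=
  ereal_sup [set (\sum_(0 <= n < size s)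
      mdist (g (nth b (a :: s) n)) (g (nth b (a :: s) n.+1)))%:E
    | s in itv_partition a b].

Definition rectifiable_curve (a b : R) g :=
  [/\ a <= b, {within `[a, b], continuous g} & (curve_length a b g < +oo)%E].

(* The curve on [0, length] satisfying
   arclength_param a b g (length of g on [a, c]) = g c; the supremum selects
   one of the parameters c at which the length from a equals t. *)
Definition arclength_param (a b : R) g (t : R) : X :=
  g (sup [set c | a <= c <= b /\ curve_length a c g = t%:E]).

Definition line_integral (rho : X -> \bar R) (a b : R) g : \bar R :=
  (\int[lebesgue_measure]_(t in `[0%R, fine (curve_length a b g)])
     rho (arclength_param a b g t))%E.

(* The index set D makes finite covers available; with infinitely many balls
   the sum could not be finite for beta = 0. *)
Definition hausdorff_content (beta : R) E : \bar R :=
  ereal_inf [set v | exists (D : set nat) (x : nat -> X) (r : nat -> R),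
    [/\ forall k, D k -> 0 < r k,
        E `<=` \bigcup_(k in D) ball (x k) (r k) &
        v = \esum_(k in D) (r k `^ beta)%:E]].

Definition annulus O (r : R) : set X := ball O (2 * r) `\` ball O r.

Definition thin O (Q : R) E :=
  exists2 C : R, 1 <= C & forall alpha : R, 0 < alpha < Q ->
    (\sum_(k <= j <oo)
        hausdorff_content alpha (E `&` annulus O (C * 2 ^+ j.+1)) *
        ((C * 2 ^+ j.+1) `^ alpha)^-1%:E)%E @[k --> \oo] --> 0%E.

Definition thick O (Q : R) F :=
  ~ metric_bounded F /\
  forall alpha : R, 0 < alpha < Q ->
    exists (delta : R) (k : nat) (C : R), [/\ 0 < delta, 1 <= C &
      forall j, (k <= j)%N ->
        ((delta * (2 ^+ j.+1) `^ alpha)%:E <=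
         hausdorff_content alpha (F `&` annulus O (C * 2 ^+ j.+1)))%E].

End MetricSpace.

Arguments separable_space {R} X.
Arguments borel {R} X.

Section MetricMeasureSpace.
Context {R : realType} {X : pmetricType R}.
(* Borel-regular measures are outer measures defined on all subsets; integrals
   are taken on the sigma-algebra of Caratheodory measurable sets. *)
Variable mu : {outer_measure set X -> \bar R}.
Implicit Types (A : set X) (u : X -> R) (rho : X -> \bar R).

Let Xmu := caratheodory_type mu.
Let m : {measure set Xmu -> \bar R} := (mu : set Xmu -> \bar R).

Definition metric_measure_space :=
  [/\ separable_space X,
      mu [set: X] <> 0%E,
      forall x : X, exists2 r : R, 0 < r & (mu (ball x r) < +oo)%E,
      borel X `<=` mu.-caratheodory &
      forall A, exists B, [/\ borel X B, A `<=` B & mu B = mu A]].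

Definition ahlfors_regular (Q : R) :=
  exists2 CQ : R, 1 <= CQ & forall (x : X) (r : R), 0 < r ->
    ((r `^ Q / CQ)%:E <= mu (ball x r) <= (CQ * r `^ Q)%:E)%E.

Definition integrable_on u A : Prop := m.-integrable (A : set Xmu) (EFin \o u).

Definition locally_L1 u :=
  forall x : X, exists2 r : R, 0 < r & integrable_on u (ball x r).

Definition upper_gradient rho u :=
  [/\ locally_L1 u,
      measurable_fun setT (rho : g_sigma_algebraType (@open X) -> \bar R),
      forall x, (0 <= rho x)%E &
      forall (a b : R) (g : R -> X), rectifiable_curve a b g ->
        (`|u (g a) - u (g b)|%:E <= line_integral rho a b g)%E].

Definition mean A (f : X -> \bar R) : \bar R :=
  ((fine (mu A))^-1%:E * \int[m]_(x in (A : set Xmu)) f x)%E.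

Definition poincare_inequality (p : R) :=
  (forall (x : X) (r : R), 0 < r -> (0 < mu (ball x r) < +oo)%E) /\
  exists (C lambda : R), [/\ 0 < C, 1 <= lambda &
    forall (x : X) (r : R) u rho, 0 < r ->
      (forall (y : X) (s : R), 0 < s -> integrable_on u (ball y s)) ->
      upper_gradient rho u ->
      let B := ball x r in
      let uB := fine (mean B (EFin \o u)) in
      (mean B (fun y => `|u y - uB|%:E) <=
       (C * r)%:E *
         (mean (ball x (lambda * r)) (fun y => rho y `^ p)) `^ p^-1)%E].

End MetricMeasureSpace.

(* Main.v *)
(* The Poincaré inequality forces X to be connected: the indicator of a clopen
   set is constant along curves, so 0 is an upper gradient of it and it is a.e.
   constant on every ball. Being also unbounded, X meets every shell around O,
   so each annulus A of inner radius r contains a ball of radius r / 3. Hence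
   mu A >= c r^Q, while Ahlfors regularity bounds mu S by C r^(Q - a) times the
   a-content of S for every S in the annulus; applied to the two parts of A this
   gives c r^a <= H^a(E ∩ A) + H^a(A \ E). Convergence of the series in the
   definition of thinness makes the first term at most half of the left side
   for all remote annuli. *)
Require Import Defs.
From HB Require Import structures.
From mathcomp Require Import all_boot all_order all_algebra.
From mathcomp Require Import all_classical all_reals all_analysis measurable_realfun.
From mathcomp Require Import ring lra.

Import Order.TTheory GRing.Theory Num.Theory.
Import numFieldNormedType.Exports.

Local Open Scope classical_set_scope.
Local Open Scope ring_scope.

(** * Connectedness from the Poincaré inequality *)

Lemma mball_open (R : realType) (X : pmetricType R) (x : X) (r : R) :
  open (ball x r).
Proof.
rewrite openE => y; rewrite ballEmdist/= => xyr.
apply/nbhs_ballP; exists (r - mdist x y) => /=; first by rewrite subr_gt0.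
move=> z; rewrite !ballEmdist/= => yz.
by rewrite (le_lt_trans (metric_triangle x y z))//; lra.
Qed.

Lemma borel_open (R : realType) (X : pmetricType R) (A : set X) :
  open A -> borel X A.
Proof. exact: sub_sigma_algebra. Qed.

(** The image of [[a, b]] is connected, so a clopen set that meets it contains it. This is applied
    to [B] or to its complement, whichever contains [g a]. *)
Lemma indic_clopen_curve (R : realType) (X : pmetricType R) (B : set X)
    (a b : R) (g : R -> X) :
  open B -> closed B -> a <= b -> {within `[a, b], continuous g} ->
  \1_B (g a) = \1_B (g b) :> R.
Proof.
move=> oB cB ab cg.
have cI := connected_continuous_connected (@segment_connected R a b) cg.
have Ia : (g @` `[a, b]) (g a) by exists a => //=; rewrite in_itv/= lexx.
have Ib : (g @` `[a, b]) (g b) by exists b => //=; rewrite in_itv/= lexx andbT.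
have clopen_image (C : set X) : open C -> closed C ->
    (g @` `[a, b]) `&` C !=set0 -> (g @` `[a, b]) `<=` C.
  move=> oC cC IC; have <- : (g @` `[a, b]) `&` C = g @` `[a, b].
    by apply: cI => //; exists C.
  exact: subIsetr.
rewrite !indicE; case: (pselect (B (g a))) => Ba.
  have /(_ _ Ib) Bb : (g @` `[a, b]) `<=` B by apply: clopen_image => //; exists (g a).
  by rewrite !mem_set.
have /(_ _ Ib) Bb : (g @` `[a, b]) `<=` ~` B.
  by apply: clopen_image; [exact: closed_openC|exact: open_closedC|exists (g a)].
by rewrite !memNset.
Qed.

Lemma upper_gradient_indic_clopen (R : realType) (X : pmetricType R)
    (mu : {outer_measure set X -> \bar R}) (B : set X) :
  (forall (x : X) (r : R), 0 < r -> integrable_on mu (\1_B : X -> R) (ball x r)) ->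
  open B -> closed B -> upper_gradient mu (cst 0%E) (\1_B : X -> R).
Proof.
move=> intB oB cB; split => //.
- by move=> x; exists 1 => //; exact: intB.
- move=> a b g [ab cg _]; rewrite (@indic_clopen_curve _ _ B a b g)//.
  by rewrite subrr normr0 /line_integral integral_ge0.
Qed.

(** One ball contains a small ball inside [B] and another inside its complement. Vanishing
    oscillation there forces the mean [uB] of the indicator to be both 1 and 0. *)
Lemma poincare_connected (R : realType) (X : pmetricType R)
    (mu : {outer_measure set X -> \bar R}) (p : R) :
  0 < p -> borel X `<=` mu.-caratheodory -> poincare_inequality mu p ->
  connected [set: X].
Proof.
move=> p0 borelmu [muball [C [la [C0 la1 PI]]]] B [x Bx] [U oU BU] [V cV BV].
have oB : open B by rewrite BU setTI.
have cB : closed B by rewrite BV setTI.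
apply: contrapT => BT.
have [y By] : exists y, ~ B y.
  by apply/not_existsP => By; apply: BT; apply/seteqP; split=> // z _; apply: contrapT.
have [e1 /= e10 xB] : exists2 e : R, 0 < e & ball x e `<=` B.
  by move: oB; rewrite openE => /(_ _ Bx) /nbhs_ballP[e e0 eB]; exists e.
have [e2 /= e20 yB] : exists2 e : R, 0 < e & ball y e `<=` ~` B.
  by move/closed_openC : cB; rewrite openE => /(_ _ By) /nbhs_ballP[e e0 eB]; exists e.
pose Xmu := caratheodory_type mu.
pose m : {measure set Xmu -> \bar R} := (mu : set Xmu -> \bar R).
have mopen (A : set X) : open A -> measurable (A : set Xmu).
  by move=> oA; apply: borelmu; exact: borel_open.
have mball z r : measurable (ball z r : set Xmu) by apply: mopen; exact: mball_open.
have mB : measurable (B : set Xmu) by exact: mopen.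
have intB (z : X) (r : R) : 0 < r -> integrable_on mu (\1_B : X -> R) (ball z r).
  move=> r0; apply/integrableP; split.
    by apply/measurable_EFinP; exact: (@measurable_indic _ Xmu).
  rewrite (_ : (fun _ => _) = (fun t : Xmu => (\1_B t)%:E)); last first.
    by apply/funext => t /=; rewrite ger0_norm// indicE ler0n.
  rewrite (@integral_indic _ Xmu _ m)//.
  have /andP[_] := muball z r r0; apply: le_lt_trans.
  by apply: le_outer_measure; exact: subIsetr.
(* This radius makes [ball x s] contain both [ball x e1] and [ball y e2]. *)
pose s := mdist x y + e1 + e2.
have d0 : 0 <= mdist x y by exact: mdist_ge0.
have s0 : 0 < s by rewrite /s; lra.
have xs : ball x e1 `<=` ball x s by apply: le_ball; rewrite /s; lra.
have ys : ball y e2 `<=` ball x s.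
  move=> z; rewrite !ballEmdist/= => yz.
  by rewrite (le_lt_trans (metric_triangle x y z))// /s; lra.
have := PI x s (\1_B : X -> R) (cst 0%E) s0 intB
  (@upper_gradient_indic_clopen _ _ _ _ intB oB cB).
rewrite /=; set uB := fine _; rewrite /mean -/m.
(* The right-hand side vanishes because [p] and [p^-1] are nonzero; a zero exponent would give the
   value 1. *)
rewrite [X in (_ <= _ * ((_ * X) `^ _))%E]integral0_eq; last first.
  by move=> z _ /=; apply: poweR0r; exact: lt0r_neq0.
rewrite mule0 poweR0r ?invr_eq0 ?gt_eqF// mule0.
have mus0 : 0 < fine (mu (ball x s)) by rewrite fine_gt0// muball.
rewrite lee_pdivrMl// mule0.
set f := (fun y0 : X => _) => intf.
have mf : measurable_fun (ball x s : set Xmu) (f : Xmu -> \bar R).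
  apply/measurable_EFinP; apply: measurableT_comp => //.
  apply: measurable_funB => //; exact: (@measurable_indic _ Xmu).
(* If the indicator equals [c] on a small ball, then [|c - uB|] times the positive measure of that
   ball is at most the integral of [f], which is at most 0. *)
have cstf (z : X) (e c : R) : 0 < e -> ball z e `<=` ball x s ->
    (forall t, ball z e t -> \1_B t = c) -> c = uB.
  move=> e0 zs zc; apply/eqP; rewrite -subr_eq0 -normr_le0 -lee_fin.
  have /andP[muz _] := muball z e e0.
  rewrite -(@pmule_lle0 _ (mu (ball z e)))//.
  rewrite -(@integral_cst _ Xmu _ m (ball z e))//.
  apply: le_trans intf.
  rewrite (@eq_integral _ Xmu _ m _ f) => [|t /set_mem zt]; last by rewrite /f zc.
  by apply: (@ge0_subset_integral _ Xmu _ m) => // t _; rewrite lee_fin.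
have := cstf x e1 1 e10 xs; rewrite -(cstf y e2 0 e20 ys) => [H|t /yB Bt].
  suff : (1 : R) = 0 by apply/eqP; exact: oner_neq0.
  by apply: H => t /xB Bt; rewrite indicE mem_set.
by rewrite indicE memNset.
Qed.

(** * Measure of annuli in a connected unbounded space *)

(** If the shell is empty, [ball O s] is closed: a limit point lies within [t - s] of the ball,
    hence at distance less than [t] from [O], hence less than [s]. A nonempty clopen ball is all of
    [X], which would then be bounded. *)
Lemma shell_nonempty (R : realType) (X : pmetricType R) (O : X) (s t : R) :
  connected [set: X] -> ~ metric_bounded [set: X] -> 0 < s -> s < t ->
  exists x, s <= mdist O x < t.
Proof.
move=> cX unbX s0 st; apply: contrapT => /forallNP shell0.
have ballT : ball O s = [set: X].
  apply: cX.
  - by exists O; exact: ballxx.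
  - by exists (ball O s); [exact: mball_open|rewrite setTI].
  - exists (ball O s); last by rewrite setTI.
    move=> x /(_ (ball x (t - s))) []; first by apply: nbhsx_ballx; rewrite subr_gt0.
    move=> y; rewrite !ballEmdist/= => -[Oy xy].
    rewrite ltNge; apply/negP => sx; apply: (shell0 x); rewrite sx/=.
    have := metric_triangle O y x; rewrite (metric_sym y x); lra.
apply: unbX; exists (s + s) => x y _ _.
have : ball O s x by rewrite ballT.
have : ball O s y by rewrite ballT.
rewrite !ballEmdist/= => Oy Ox.
have := metric_triangle x O y; rewrite (metric_sym x O); lra.
Qed.

Lemma ahlfors_annulus_ge (R : realType) (X : pmetricType R)
    (mu : {outer_measure set X -> \bar R}) (O : X) (CQ Q r : R) :
  connected [set: X] -> ~ metric_bounded [set: X] -> 0 < r ->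
  (forall (x : X) (r : R), 0 < r ->
    ((r `^ Q / CQ)%:E <= mu (ball x r) <= (CQ * r `^ Q)%:E)%E) ->
  (((r / 3) `^ Q / CQ)%:E <= mu (annulus O r))%E.
Proof.
move=> cX unbX r0 regmu.
(* The center is taken in the middle third of the range from [r] to [2 * r], which leaves a margin
   of [r / 3] on both sides. *)
have s0 : 0 < 4 / 3 * r by lra.
have st : 4 / 3 * r < 5 / 3 * r by lra.
have [x /andP[rx xr]] := @shell_nonempty R X O _ _ cX unbX s0 st.
have /andP[+ _] := regmu x (r / 3) ltac:(lra).
move=> /le_trans; apply; apply: le_outer_measure => y.
rewrite ballEmdist/= => xy; rewrite /annulus !ballEmdist/=; split => /=.
  have := metric_triangle O x y; lra.
move=> Oy; have := metric_triangle O y x; rewrite (metric_sym y x); lra.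
Qed.

(** * Hausdorff content against an Ahlfors regular measure *)

Lemma hausdorff_content_ge0 (R : realType) (X : pmetricType R) (a : R) (S : set X) :
  (0 <= hausdorff_content a S)%E.
Proof.
apply: le_ereal_inf_tmp => _ [D [x [r [_ _ ->]]]].
by apply: esum_ge0 => k _; rewrite lee_fin powR_ge0.
Qed.

Lemma hausdorff_content0 (R : realType) (X : pmetricType R) (a : R) :
  hausdorff_content a (set0 : set X) = 0%E.
Proof.
apply/eqP; rewrite eq_le hausdorff_content_ge0 andbT.
apply: ereal_inf_lbound; exists set0, (fun=> point), (fun=> 1).
by split => //; rewrite esum_set0.
Qed.

Lemma powR_subrK (R : realType) (t a b : R) :
  0 < t -> t `^ b = t `^ (b - a) * t `^ a.
Proof. by move=> t0; rewrite -powRD ?subrK// (gt_eqF t0) implybT. Qed.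

(* Covers with small balls are compared with mu by subadditivity; a covering
   ball of radius larger than r already costs r `^ a. *)
Lemma ahlfors_le_content (R : realType) (X : pmetricType R)
    (mu : {outer_measure set X -> \bar R}) (O : X) (CQ Q a r : R) (S : set X) :
  0 < CQ -> 0 <= a -> a <= Q -> 0 < r ->
  (forall (x : X) (r : R), 0 < r -> (mu (ball x r) <= (CQ * r `^ Q)%:E)%E) ->
  S `<=` ball O r ->
  (mu S <= (CQ * r `^ (Q - a))%:E * hausdorff_content a S)%E.
Proof.
move=> CQ0 a0 aQ r0 regmu Sr.
have K0 : 0 < CQ * r `^ (Q - a) by rewrite mulr_gt0// powR_gt0.
rewrite -lee_pdivrMl//; apply: le_ereal_inf_tmp => _ [D [x [e [e0 SD ->]]]].
rewrite lee_pdivrMl//.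
case: (pselect (exists2 k, D k & r < e k)) => [[k Dk rk]|small].
  apply: le_trans (le_outer_measure mu _ _ Sr) _.
  apply: le_trans (regmu O r r0) _.
  rewrite (powR_subrK _ _ a Q)// mulrA EFinM; apply: lee_wpmul2l; first by rewrite lee_fin ltW.
  apply: esum_ge; exists [set k]; first by split=> // _ ->.
  by rewrite fsbig_set1 lee_fin ge0_ler_powR// ?nnegrE ltW// e0.
(* Costs and balls are extended by 0 and the empty set outside [D], so that countable subadditivity
   applies to a full sequence. *)
pose c k : \bar R := if k \in D then (e k `^ a)%:E else 0%E.
have c0 k : (0 <= c k)%E by rewrite /c; case: ifP => // _; rewrite lee_fin powR_ge0.
rewrite esum_mkcond -nneseries_esumT// -nneseriesZl; last by move=> k _; exact: c0.
pose F k := if k \in D then ball (x k) (e k) else set0.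
apply: (@le_trans _ _ (mu (\bigcup_k F k))).
  apply: le_outer_measure => z /SD[k Dk zk]; exists k => //.
  by rewrite /F mem_set.
apply: le_trans (outer_measure_sigma_subadditive mu F) _.
apply: lee_nneseries => // k _; rewrite /F /c.
case: ifPn => [/set_mem Dk|_]; last by rewrite outer_measure0 mule0.
have ek := e0 _ Dk.
have ekr : e k <= r by rewrite leNgt; apply/negP => rk; apply: small; exists k.
apply: le_trans (regmu _ _ ek) _.
(* The factor [e k]^ (Q - a)[is at most]r [^ (Q - a)], since [e k <= r] and [Q - a] is
   nonnegative. *)
rewrite lee_fin (powR_subrK _ _ a Q)// mulrA ler_wpM2r ?powR_ge0// ler_pM2l//.
by rewrite ge0_ler_powR// ?nnegrE ?subr_ge0// ltW.
Qed.

(** The constant is uniform in [E] and [r], so that one threshold serves all remote annuli. *)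
Lemma ahlfors_annulus_content_ge (R : realType) (X : pmetricType R)
    (mu : {outer_measure set X -> \bar R}) (O : X) (Q a : R) :
  connected [set: X] -> ~ metric_bounded [set: X] -> ahlfors_regular mu Q ->
  0 <= a -> a <= Q ->
  exists2 c : R, 0 < c & forall (E : set X) (r : R), 0 < r ->
    ((c * r `^ a)%:E <= hausdorff_content a (E `&` annulus O r) +
                        hausdorff_content a (~` E `&` annulus O r))%E.
Proof.
move=> cX unbX [CQ CQ1 regmu] a0 aQ.
have CQ0 : 0 < CQ by rewrite (lt_le_trans _ CQ1).
exists (3^-1 `^ Q / CQ / (CQ * 2 `^ (Q - a))) => [|E r r0].
  by rewrite !(divr_gt0, mulr_gt0, powR_gt0)// invr_gt0.
set A := annulus O r.
have content (S : set X) : (mu (S `&` A) <=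
    (CQ * (2 * r) `^ (Q - a))%:E * hausdorff_content a (S `&` A))%E.
  apply: (@ahlfors_le_content _ _ _ O) => //; first by rewrite mulr_gt0.
    by move=> x t t0; have /andP[] := regmu x t t0.
  by move=> z [_ []].
have K0 : 0 < CQ * (2 * r) `^ (Q - a) by rewrite mulr_gt0// powR_gt0// mulr_gt0.
have -> : 3^-1 `^ Q / CQ / (CQ * 2 `^ (Q - a)) * r `^ a =
    (CQ * (2 * r) `^ (Q - a))^-1 * ((r / 3) `^ Q / CQ).
  rewrite !powRM ?invr_ge0// ?ltW// (powR_subrK _ r a Q)//.
  field; rewrite !gt_eqF// powR_gt0//.
rewrite EFinM lee_pdivrMl//.
rewrite ge0_muleDr ?hausdorff_content_ge0//.
apply: le_trans (ahlfors_annulus_ge _ _ _ O _ _ _ cX unbX r0 regmu) _.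
apply: le_trans (leeD (content E) (content (~` E))).
by rewrite 2!(setIC _ A); exact: le_outer_measureIC.
Qed.

(** Produces points far from [O], from which unboundedness follows. *)
Lemma content_annulus_neq0 (R : realType) (X : pmetricType R) (O : X)
    (a d r : R) (F : set X) :
  0 < d -> (d%:E <= hausdorff_content a (F `&` annulus O r))%E ->
  exists2 x, F x & r <= mdist O x.
Proof.
move=> d0 dF.
have /set0P[x [Fx []]] : F `&` annulus O r != set0.
  by apply: contraTneq dF => ->; rewrite hausdorff_content0 -ltNge lte_fin.
by rewrite !ballEmdist/= => _ /negP; rewrite -leNgt; exists x.
Qed.

(** * Content of the complement in remote annuli *)

Theorem lemma3p3 (R : realType) (X : pmetricType R)
    (mu : {outer_measure set X -> \bar R}) (O : X) (Q p : R) (E : set X) :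
  1 < Q ->
  1 <= p ->
  metric_measure_space mu ->
  ~ metric_bounded [set: X] ->
  ahlfors_regular mu Q ->
  poincare_inequality mu p ->
  thin O Q E ->
  thick O Q (~` E).
Proof.
move=> Q1 p1 [_ _ _ borelmu _] unbX regmu PI [C C1 thinE].
have cX : connected [set: X].
  by apply: (poincare_connected _ _ _ _ _ borelmu PI); rewrite (lt_le_trans ltr01).
have C0 : 0 < C by rewrite (lt_le_trans ltr01).
have r0 j : 0 < C * 2 ^+ j.+1 by rewrite mulr_gt0// exprn_gt0.
(* This estimate, with the constant [C] of thinness, serves both halves of thickness. *)
have large (a : R) : 0 < a < Q -> exists2 d : R, 0 < d &
    exists k, forall j, (k <= j)%N ->
      ((d * (C * 2 ^+ j.+1) `^ a)%:E <=
       hausdorff_content a (~` E `&` annulus O (C * 2 ^+ j.+1)))%E.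
  move=> /[dup] aQ /andP[/ltW a0 /ltW leaQ].
  have [c c0 cE] := ahlfors_annulus_content_ge _ _ _ O _ _ cX unbX regmu a0 leaQ.
  have c20 : 0 < c / 2 by rewrite divr_gt0.
  exists (c / 2) => //.
  have : \forall k \near \oo, (\sum_(k <= j <oo)
        hausdorff_content a (E `&` annulus O (C * 2 ^+ j.+1)) *
        ((C * 2 ^+ j.+1) `^ a)^-1%:E < (c / 2)%:E)%E.
    have nb : nbhs (0%E : \bar R) [set x | (x < (c / 2)%:E)%E].
      by apply: open_ereal_lt'; rewrite lte_fin.
    exact: (thinE a aQ _ nb).
  move=> [k _ kE]; exists k => j kj.
  set r := C * 2 ^+ j.+1.
  have ra0 : 0 < r `^ a by rewrite powR_gt0// r0.
  (* The term of index [j] is the first of the tail starting at [j]; all terms are nonnegative and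
     that tail is below [c / 2]. *)
  have Ej : (hausdorff_content a (E `&` annulus O r) <= (c / 2 * r `^ a)%:E)%E.
    rewrite EFinM -lee_pdivrMr//; apply: le_trans (ltW (kE j kj)).
    have := @nneseries_lim_ge R (fun j => hausdorff_content a
      (E `&` annulus O (C * 2 ^+ j.+1)) * ((C * 2 ^+ j.+1) `^ a)^-1%:E)%E xpredT j j.+1.
    rewrite big_nat1; apply => n _ _.
    by rewrite mule_ge0 ?hausdorff_content_ge0// lee_fin invr_ge0 powR_ge0.
  have := le_trans (cE E r (r0 j)) (leeD Ej (lexx _)).
  rewrite -leeBlDl// -EFinB; apply: le_trans.
  by rewrite lee_fin; lra.
split=> [[M bM]|a aQ].
  (* The exponent 1 is admissible because [1 < Q]. *)
  have [d d0 [k kF]] := large 1 ltac:(by rewrite ltr01).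
  have far j : (k <= j)%N -> exists2 x, (~` E) x & C * 2 ^+ j.+1 <= mdist O x.
    move=> kj; apply: content_annulus_neq0 (kF j kj).
    by rewrite mulr_gt0// powR_gt0// r0.
  have [x Ex _] := far k (leqnn k).
  (* Since [2 ^+ n.+1] exceeds [n], the point [y] chosen next is farther from [O] than
     [M + mdist O x], so [mdist x y] exceeds [M]. *)
  pose n := Num.bound `|M + mdist O x|.
  have [y Ey] := far (maxn k n) (leq_maxl _ _).
  have nM : `|M + mdist O x| < n%:R by exact: archi_boundP.
  have : n%:R <= C * 2 ^+ (maxn k n).+1.
    rewrite -[leLHS]mul1r ler_pM// -natrX ler_nat.
    by rewrite (leq_trans (leq_maxr k n))// ltnW// (ltn_trans (ltnSn _))// ltn_expl.
  have := bM _ _ Ex Ey; have := metric_triangle O x y.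
  have := ler_norm (M + mdist O x); lra.
have [d d0 [k kF]] := large a aQ.
have /andP[a0 _] := aQ.
exists d, k, C; split=> // j /kF; apply: le_trans.
(* Thickness is normalized by [2 ^+ j.+1] rather than [C * 2 ^+ j.+1]; the passage uses [1 <= C]. *)
rewrite lee_fin ler_pM2l//; apply: ge0_ler_powR; rewrite ?nnegrE ?(ltW a0)//.
- by rewrite (ltW (r0 j)).
- by rewrite ler_peMl.
Qed.
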